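(* Let $\theta_1,\dots,\theta_r$ be real numbers, and let $m$, $d$, $h_{k,j}$ and $\nu_\theta$ be as defined in the context. Let $\Gamma_\theta=\{(e^{i\theta_1X},\dots,e^{i\theta_rX}) : X\in\mathbb{Z}\}\subset\mathbb{T}^r$ and $$H_\theta=\left\{\left(z_1^d,\dots,z_m^d,\prod_{k=1}^m z_k^{h_{k,m+1}},\dots,\prod_{k=1}^m z_k^{h_{k,r}}\right) : (z_1,\dots,z_m)\in\mathbb{T}^m\right\}\subset\mathbb{T}^r .$$ Let $\mu_{H_\theta}$ be the normalized Haar measure of $H_\theta$, for $0\le a\le d-1$ let $\mu_a$ be the pushforward of $\mu_{H_\theta}$ to $\nu_\theta^aH_\theta$ (under $z\mapsto\nu_\theta^a z$), and let $\mu_\theta=\frac1d\sum_{a=0}^{d-1}\mu_a$. Then the topological closure of $\Gamma_\theta$ in $\mathbb{T}^r$ is $$\overline{\Gamma_\theta}=\bigcup_{a=0}^{d-1}\nu_\theta^aH_\theta=\langle\nu_\theta\rangle H_\theta,$$ and $\Gamma_\theta$ is equidistributed in $\overline{\Gamma_\theta}$ with respect to $\mu_\theta$, that is, for every continuous $f:\mathbb{T}^r\to\mathbb{C}$, $$\frac1X\sum_{n\le X}f\left(e^{i\theta_1n},\dots,e^{i\theta_rn}\right)\underset{X\to+\infty}{\longrightarrow}\int_{\overline{\Gamma_\theta}}f\,\mathrm{d}\mu_\theta .$$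
   Context: $\mathbb{T}=\{z\in\mathbb{C}:|z|=1\}$, and $\mathbb{T}^r$ is a group under coordinatewise multiplication. Sums over $n\le X$ are over positive integers $n$. Let $m\ge0$ be defined by $m+1=\dim_{\mathbb{Q}}\mathrm{Span}_{\mathbb{Q}}(\pi,\theta_1,\dots,\theta_r)$. After reindexing the $\theta_i$, it is assumed that $\{2\pi,\theta_1,\dots,\theta_m\}$ is a basis of this $\mathbb{Q}$-vector space, and one writes $\theta_j=2\pi c_j+\sum_{k=1}^m b_{k,j}\theta_k$ for $m+1\le j\le r$, with $c_j,b_{k,j}\in\mathbb{Q}$. Let $d\ge1$ be the least common multiple of the denominators of all the $c_j$ and $b_{k,j}$ ($d=1$ if $m=r$), and $h_{k,j}=d\,b_{k,j}\in\mathbb{Z}$. Let $\nu_\theta=(e^{i\theta_1},\dots,e^{i\theta_r})\in\mathbb{T}^r$, and let $\langle\nu_\theta\rangle$ be the subgroup it generates. If $m=0$, $H_\theta$ is the trivial subgroup. *)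

(* Defs.v *)
From HB Require Import structures.
From mathcomp Require Import all_boot all_order all_algebra complex.
From mathcomp Require Import all_classical all_reals all_analysis.

Set Implicit Arguments.
Unset Strict Implicit.
Unset Printing Implicit Defensive.

Import Order.TTheory GRing.Theory Num.Theory.
Import numFieldNormedType.Exports.

Local Open Scope classical_set_scope.
Local Open Scope ring_scope.
Local Open Scope complex_scope.

Section Qlinear.
Variable R : realType.

Definition Qspan n (v : 'I_n -> R) : set R :=
  [set x | exists a : 'I_n -> rat, x = \sum_(i < n) ratr (a i) * v i].

Definition Qfree n (v : 'I_n -> R) : Prop :=
  forall a : 'I_n -> rat, \sum_(i < n) ratr (a i) * v i = 0 -> forall i, a i = 0.

Definition Qbasis (V : set R) n (v : 'I_n -> R) : Prop :=
  Qfree v /\ Qspan v = V.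

Definition Qdim (V : set R) (n : nat) : Prop :=
  exists v : 'I_n -> R, Qbasis V v.

(* the family (x, v_0, ..., v_(n-1)) *)
Definition fcons n (x : R) (v : 'I_n -> R) (i : 'I_n.+1) : R :=
  oapp v x (unlift ord0 i).

End Qlinear.

Definition lcm_denoms m s (c : 'I_s -> rat) (b : 'I_m -> 'I_s -> rat) : nat :=
  \big[lcmn/1%N]_(j < s)
    lcmn `|denq (c j)|%N (\big[lcmn/1%N]_(k < m) `|denq (b k j)|%N).

(* R[i] packed as a numFieldType: the topology of a numFieldType is not
   inferred from the bare carrier R[i]. *)
Definition Cplx (R : realType) : numFieldType := R[i].

Section Circle.
Variable R : realType.
Local Notation C := (Cplx R).

Record circle := Circle { cval :> C; _ : `|cval| == 1 }.

HB.instance Definition _ := [isSub for cval].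
HB.instance Definition _ := [Choice of circle by <:].

Lemma circleP (z : circle) : `|cval z| = 1.
Proof. by case: z => z /= /eqP. Qed.

Fact circle_one_subproof : `|1 : C| == 1.
Proof. by rewrite normr1. Qed.
Definition circle_one := Circle circle_one_subproof.

Fact circle_mul_subproof (x y : circle) : `|cval x * cval y| == 1.
Proof. by rewrite normrM !circleP mulr1. Qed.
Definition circle_mul x y := Circle (circle_mul_subproof x y).

Fact circle_inv_subproof (x : circle) : `|(cval x)^-1| == 1.
Proof. by rewrite normfV circleP invr1. Qed.
Definition circle_inv x := Circle (circle_inv_subproof x).

Fact circle_mulA : associative circle_mul.
Proof. by move=> x y z; apply/val_inj; rewrite /= mulrA. Qed.
Fact circle_mul1 : left_id circle_one circle_mul.
Proof. by move=> x; apply/val_inj; rewrite /= mul1r. Qed.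
Fact circle_mulr1 : right_id circle_one circle_mul.
Proof. by move=> x; apply/val_inj; rewrite /= mulr1. Qed.
Fact cval_neq0 (x : circle) : cval x != 0.
Proof. by rewrite -normr_eq0 circleP oner_neq0. Qed.
Fact circle_mulV : left_inverse circle_one circle_inv circle_mul.
Proof. by move=> x; apply/val_inj; rewrite /= mulVf ?cval_neq0. Qed.
Fact circle_mulrV : right_inverse circle_one circle_inv circle_mul.
Proof. by move=> x; apply/val_inj; rewrite /= mulfV ?cval_neq0. Qed.

HB.instance Definition _ := isGroup.Build circle
  circle_mulA circle_mul1 circle_mulr1 circle_mulV circle_mulrV.

HB.instance Definition _ := isPointed.Build circle circle_one.
HB.instance Definition _ := Uniform.copy circle (initial_topology cval).

Fact cis_subproof (t : R) : `|(cos t +i* sin t) : C| == 1.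
Proof. by rewrite normc_def /= cos2Dsin2 sqrtr1. Qed.
Definition cis (t : R) : circle := Circle (cis_subproof t).

End Circle.

Definition torus (R : realType) (n : nat) : Type := {ptws 'I_n -> circle R}.

Section Torus.
Variables (R : realType) (n : nat).
Local Notation T := (torus R n).

HB.instance Definition _ := Uniform.on T.
HB.instance Definition _ := isPointed.Build T (fun=> 1%g).

Definition torus_mul (x y : T) : T := fun i => (x i * y i)%g.
Definition torus_inv (x : T) : T := fun i => (x i)^-1%g.

Fact torus_mulA : associative torus_mul.
Proof. by move=> x y z; apply/funext => i; rewrite /torus_mul mulgA. Qed.
Fact torus_mul1 : left_id ((fun=> 1%g) : T) torus_mul.
Proof. by move=> x; apply/funext => i; rewrite /torus_mul mul1g. Qed.
Fact torus_mulr1 : right_id ((fun=> 1%g) : T) torus_mul.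
Proof. by move=> x; apply/funext => i; rewrite /torus_mul mulg1. Qed.
Fact torus_mulV : left_inverse ((fun=> 1%g) : T) torus_inv torus_mul.
Proof. by move=> x; apply/funext => i; rewrite /torus_mul mulVg. Qed.
Fact torus_mulrV : right_inverse ((fun=> 1%g) : T) torus_inv torus_mul.
Proof. by move=> x; apply/funext => i; rewrite /torus_mul mulgV. Qed.

HB.instance Definition _ := isGroup.Build T
  torus_mulA torus_mul1 torus_mulr1 torus_mulV torus_mulrV.

End Torus.

Lemma cval_continuous (R : realType) : continuous (@cval R).
Proof. exact: initial_continuous. Qed.

Lemma circle_mul_continuous (R : realType) (a : circle R) :
  continuous (fun z : circle R => (a * z)%g).
Proof.
apply: continuous_comp_initial => z.
apply: (@cvgM _ _ (nbhs z) _ (fun=> cval a) (@cval R)); first exact: cvg_cst.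
exact: cval_continuous.
Qed.

Lemma torus_coord_continuous (R : realType) n (i : 'I_n) :
  continuous (fun z : torus R n => z i).
Proof. exact: (@proj_continuous _ (fun=> circle R)). Qed.

Lemma prod_topology_continuous (I : Type) (T : I -> topologicalType)
    (X : topologicalType) (f : X -> prod_topology T) :
  (forall i, continuous (fun x => f x i)) -> continuous f.
Proof.
move=> cf x.
have FF : Filter (f @ x) by exact: fmap_filter.
apply: (snd (@cvg_sup _ _ (fun i : I => Topological.class
    (initial_topology (fun g : (forall i, T i) => g i))) (f @ x) (f x) FF)) => i.
exact: (@continuous_comp_initial _ _ _ (fun g : (forall i, T i) => g i) f (cf i) x).
Qed.

Lemma torus_mul_continuous (R : realType) n (g : torus R n) :
  continuous (fun z : torus R n => (g * z)%g).
Proof.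
apply: (@prod_topology_continuous _ (fun=> circle R)) => i z.
apply: (@continuous_comp _ _ _ (fun w : torus R n => w i) (fun x => (g i * x)%g)).
  exact: torus_coord_continuous.
exact: circle_mul_continuous.
Qed.

Definition borel (T : ptopologicalType) : measurableType (@open T).-sigma :=
  g_sigma_algebraType (@open T).

Definition Cintegral (R : realType) d (T : measurableType d)
    (mu : {measure set T -> \bar R}) (D : set T) (f : T -> Cplx R) : Cplx R :=
  Rintegral mu D (fun x => complex.Re (f x)) +i*
  Rintegral mu D (fun x => complex.Im (f x)).

Definition is_subgroup (G : groupType) (H : set G) : Prop :=
  H 1%g /\ forall x y, H x -> H y -> H (x / y)%g.

Definition generated (G : groupType) (A : set G) : set G :=
  smallest (@is_subgroup G) A.

Definition set_mul (G : groupType) (A B : set G) : set G :=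
  [set (x * y)%g | x in A & y in B].

Section Measures.
Variables (R : realType) (n : nat).
Local Notation T := (torus R n).

Definition translate (g : T) : borel T -> borel T := fun z : T => (g * z)%g.

Fact measurable_translate g : measurable_fun setT (translate g).
Proof.
apply: (@measurability _ _ (borel T) (borel T) _ _ (@open T)) => // _ [U oU <-]; rewrite setTI.
apply: sub_sigma_algebra.
by move/continuousP : (@torus_mul_continuous R n g); apply.
Qed.

HB.instance Definition _ g :=
  isMeasurableFun.Build _ _ (borel T) (borel T) (translate g)
    (measurable_translate g).

(* A Borel probability measure on a compact subgroup H of the torus is
   identified with a Borel probability measure on the torus that gives H mass
   one; finite Borel measures on the torus are automatically regular. *)
Definition is_normalized_haar (H : set T) (mu : probability (borel T) R) : Prop :=
  mu H = 1%E /\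
  forall g, H g -> forall A : set (borel T), measurable A ->
    mu (translate g @` A) = mu A.

(* distribution mu f is the pushforward of mu under f. *)
Definition mu_coset (mu : probability (borel T) R) (nu : T) (a : nat) :
    {measure set (borel T) -> \bar R} :=
  distribution mu (translate (nu ^+ a)%g).

Definition mu_average (mu : probability (borel T) R) (nu : T) (d : nat) :
    {measure set (borel T) -> \bar R} :=
  mscale ((d%:R : R)^-1)%:nng (msum (mu_coset mu nu) d).

End Measures.

Definition torus_point (R : realType) r (theta : 'I_r -> R) (t : R) : torus R r :=
  fun j => cis (theta j * t).

Definition nu_theta (R : realType) r (theta : 'I_r -> R) : torus R r :=
  fun j => cis (theta j).

Definition Gamma_theta (R : realType) r (theta : 'I_r -> R) : set (torus R r) :=
  [set torus_point theta X%:~R | X in [set: int]].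

Definition expgz (G : groupType) (x : G) (k : int) : G :=
  match k with Posz n => (x ^+ n)%g | Negz n => (x ^- n.+1)%g end.

Definition H_param (R : realType) m s (d : nat) (h : 'I_m -> 'I_s -> int)
    (z : torus R m) : torus R (m + s) :=
  fun i => match fintype.split i with
           | inl k => (z k ^+ d)%g
           | inr j => (\prod_(k < m) expgz (z k) (h k j))%g
           end.

Definition H_theta (R : realType) m s (d : nat) (h : 'I_m -> 'I_s -> int) :
    set (torus R (m + s)) :=
  range (H_param d h).

(* Main.v *)
Require Import Defs.
From mathcomp Require Import all_boot all_order all_algebra complex.
From mathcomp Require Import all_classical all_reals all_analysis.
From mathcomp Require Import measurable_realfun.
From mathcomp Require Import ring lra.

(** Write [nu] for [nu_theta], [H] for [H_theta] and [U] for the union of the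
    cosets [nu ^+ a * H].

    The closure.  Multiplying the relations between the angles by [d] turns
    their rational coefficients into integers, so that [nu ^+ d] is the point of
    [H] with parameters [w_k = e^(i theta_k)], [k < m] ([nu_theta_expd]).  Hence
    [U] is a subgroup containing every power of [nu], and it is compact because
    [H] is a continuous image of a torus; so it contains the closure of the
    orbit.  Conversely [nu ^+ (a + d n)] is [nu ^+ a] times the point of [H] with
    parameters [w ^+ n].  As [2 pi, theta_1, .., theta_m] are free over the
    rationals, Kronecker's theorem ([kronecker_approximation]) says that the
    powers [w ^+ n] are dense in the [m]-torus, and these points are dense in
    [nu ^+ a * H].

    Kronecker's theorem is proved by Bohr's method ([bohr_approximation]).  If no
    [w ^+ n] came close to [alpha], the product of the [1 + w_k ^+ n / alpha_k]
    would stay bounded away from its maximum [2 ^+ m] in absolute value.  The mean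
    square over [n] of the [p]-th power of this product is computed exactly, since
    the monomials in [w] are distinct characters and are orthogonal in the mean
    ([mean_square_le]); it is only polynomially smaller in [p] than [4 ^+ (m p)],
    which is a contradiction when [p] is large.

    Equidistribution.  No Fourier analysis is needed once the orbit is dense.  A
    continuous [g] is uniformly continuous for a translation-invariant distance,
    so its averages along orbits are equicontinuous; and starting the orbit at
    [nu ^+ j] instead of [1] changes an average over [N] terms by [O(j / N)].
    Density and compactness then give that for large [N] the average is
    nearly the same from all starting points of [U] ([birkhoff_sum_uniform]).  The
    measure [mu_average] is invariant under [nu], because [nu ^+ d] lies in [H]
    and translation by [nu] permutes the [d] cosets cyclically
    ([mu_average_invariant]).  So the integral of the average over
    the starting point is the integral of [g], which must be the limit
    ([birkhoff_average_cvg]). *)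

Set Implicit Arguments.
Unset Strict Implicit.
Unset Printing Implicit Defensive.

Import Order.TTheory GRing.Theory Num.Theory.
Import numFieldNormedType.Exports.

Local Open Scope classical_set_scope.
Local Open Scope ring_scope.
Local Open Scope complex_scope.

(** * Mean squares of exponential sums *)

Lemma geometric_sum_bound (F : numFieldType) (w : F) N :
  `|w| = 1 -> w != 1 -> `|\sum_(n < N) w ^+ n| <= 2 / `|w - 1|.
Proof.
move=> w1 wN1; have w1_gt0 : 0 < `|w - 1| by rewrite normr_gt0 subr_eq0.
rewrite ler_pdivlMr// mulrC -normrM -subrX1.
by rewrite (le_trans (ler_normB _ _))// normrX w1 expr1n normr1.
Qed.

Lemma natmul_bounded_le0 (R : realType) (x E : R[i]) :
  x \is Num.real -> E \is Num.real -> (forall N : nat, N%:R * x <= E) -> x <= 0.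
Proof.
move=> /complex_realP[a ->] /complex_realP[e ->] xE.
rewrite (lecR _ 0) leNgt; apply/negP => a_gt0.
have := xE (Num.truncn (e / a)).+1.
rewrite -[_%:R](rmorph_nat (real_complex R)) -rmorphM lecR -ler_pdivlMr//.
by rewrite leNgt truncnS_gt.
Qed.

(** Expanding the squares and averaging over [n < N], the diagonal contributes
    exactly the sum of the [`|c i| ^+ 2], while each off-diagonal pair
    contributes a geometric sum, bounded independently of [N] since
    [zeta i / zeta j] is not [1].  Dividing by a large [N] leaves the
    diagonal. *)
Lemma mean_square_le (R : realType) (I : finType) (c zeta : I -> R[i]) (B : R[i]) :
  (forall i, `|zeta i| = 1) -> injective zeta ->
  (forall n, `|\sum_i c i * zeta i ^+ n| ^+ 2 <= B) ->
  \sum_i `|c i| ^+ 2 <= B.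
Proof.
move=> zeta1 zeta_inj FB.
have B_real : B \is Num.real by apply: ger0_real; apply: le_trans (FB 0); rewrite exprn_ge0.
(* On the unit circle the conjugate is the inverse. *)
pose w i j := zeta i * (zeta j)^*.
have w1 i j : `|w i j| = 1 by rewrite normrM normcJ !zeta1 mulr1.
have wN1 i j : i != j -> w i j != 1.
  apply: contraNneq => wij; apply/eqP/zeta_inj.
  have := sqr_normc (zeta j); rewrite zeta1 expr1n => zj.
  by rewrite -[zeta i]mulr1 zj mulrCA -/(w i j) wij mulr1.
pose E := \sum_i \sum_(j | j != i) `|c i * (c j)^*| * (2 / `|w i j - 1|).
have E_ge0 : 0 <= E.
  by apply: sumr_ge0 => i _; apply: sumr_ge0 => j _; rewrite mulr_ge0// divr_ge0.
rewrite -subr_le0; apply: (@natmul_bounded_le0 _ _ E) => [||N].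
- rewrite rpredB//; apply: ger0_real; apply: sumr_ge0 => i _; exact: exprn_ge0.
- exact: ger0_real.
have key : \sum_(n < N) `|\sum_i c i * zeta i ^+ n| ^+ 2 =
    N%:R * \sum_i `|c i| ^+ 2 +
    \sum_i \sum_(j | j != i) c i * (c j)^* * \sum_(n < N) w i j ^+ n.
  transitivity (\sum_(n < N) \sum_i \sum_j c i * (c j)^* * w i j ^+ n).
    apply: eq_bigr => n _; rewrite sqr_normc rmorph_sum big_distrlr/=.
    apply: eq_bigr => i _; apply: eq_bigr => j _.
    by rewrite rmorphM rmorphXn exprMn mulrACA.
  rewrite exchange_big mulr_sumr -big_split; apply: eq_bigr => i _ /=.
  rewrite exchange_big (bigD1 i)//=; congr (_ + _).
    rewrite -mulr_sumr -sqr_normc mulrC; congr (_ * _).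
    rewrite (eq_bigr (fun=> 1)) ?sumr_const ?card_ord// => n _.
    by rewrite /w -sqr_normc zeta1 !expr1n.
  by apply: eq_bigr => j _; rewrite mulr_sumr.
have NB : \sum_(n < N) `|\sum_i c i * zeta i ^+ n| ^+ 2 <= N%:R * B.
  rewrite mulr_natl -[X in B *+ X]card_ord -sumr_const.
  by apply: ler_sum => n _; exact: FB.
rewrite mulrBr lerBlDr -[X in X <= _](addrK
  (\sum_i \sum_(j | j != i) c i * (c j)^* * \sum_(n < N) w i j ^+ n)) -key.
rewrite addrC lerD//.
set S := \sum_i _ in key *.
have S_real : S \is Num.real.
  rewrite -(rpredDl _ (_ : N%:R * \sum_i `|c i| ^+ 2 \is Num.real)) -?key.
    by apply: ger0_real; apply: sumr_ge0 => n _; rewrite exprn_ge0.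
  apply: rpredM => //; first exact: realn.
  by apply: ger0_real; apply: sumr_ge0 => n _; rewrite exprn_ge0.
apply: le_trans (_ : `|S| <= _).
  by rewrite -normrN real_ler_norm ?rpredN.
rewrite (le_trans (ler_norm_sum _ _ _))//; apply: ler_sum => i _.
rewrite (le_trans (ler_norm_sum _ _ _))//; apply: ler_sum => j ji.
by rewrite normrM ler_wpM2l// geometric_sum_bound// wN1// eq_sym.
Qed.

(** * Auxiliary inequalities *)

Lemma bernoulli_le (F : realDomainType) (t : F) n : 0 <= t -> 1 + n%:R * t <= (1 + t) ^+ n.
Proof.
move=> t_ge0; elim: n => [|n IHn]; first by rewrite mul0r addr0.
rewrite exprS (le_trans _ (ler_wpM2l _ IHn)) ?addr_ge0//.
have : 0 <= n%:R * t * t by rewrite !mulr_ge0.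
rewrite -natr1; lra.
Qed.

(** For [p = q * m] the left-hand side is the [m]-th power of
    [(q * m + 1) * rho ^+ q], so it is enough to make this less than [1] by
    choosing [q].  With [rho = y ^+ 2] and [t = 1 - y], Bernoulli's
    inequality gives [y ^+ q * (1 + q t) <= 1], whence
    [rho ^+ q <= 1 / (1 + q t) ^+ 2]; the quadratic decay in [q] beats the linear
    factor. *)
Lemma polynomial_times_geometric_lt1 (F : archiRcfType) (rho : F) m :
  0 <= rho -> rho < 1 -> exists p : nat, p.+1%:R ^+ m * rho ^+ p < 1.
Proof.
case: m => [|m] rho_ge0 rho_lt1; first by exists 1; rewrite expr0 mul1r.
pose y := Num.sqrt rho; pose t := 1 - y.
have y_ge0 : 0 <= y by exact: sqrtr_ge0.
have y2 : y ^+ 2 = rho by rewrite sqr_sqrtr.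
have t_gt0 : 0 < t by rewrite subr_gt0 -(@ltr_pXn2r _ 2)// ?nnegrE// y2 expr1n.
pose q := (Num.truncn (m.+1%:R / t ^+ 2)).+1.
have qt : m.+1%:R < q%:R * t ^+ 2.
  by rewrite -ltr_pdivrMr ?exprn_gt0// truncnS_gt.
have yq : y ^+ q * (1 + q%:R * t) <= 1.
  rewrite (le_trans (ler_wpM2l _ (bernoulli_le q (ltW t_gt0))))// ?exprn_ge0//.
  rewrite -exprMn exprn_ile1//; rewrite /t; nra.
have [y0|y_neq0] := eqVneq y 0.
  by exists 1; rewrite -y2 y0 expr0n expr1 mulr0.
have yq_gt0 : 0 < y ^+ q by rewrite exprn_gt0// lt_def y_neq0.
exists (q * m.+1)%N.
suff lt1 : (q * m.+1).+1%:R * rho ^+ q < 1.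
  rewrite exprM -exprMn exprn_ilt1//.
  by rewrite mulr_ge0// exprn_ge0.
rewrite -y2 exprAC.
have q_gt0 : 0 < q%:R :> F by rewrite ltr0n.
rewrite (@lt_le_trans _ _ ((1 + q%:R * t) ^+ 2 * (y ^+ q) ^+ 2))//.
  have -> : (q * m.+1).+1%:R = q%:R * m.+1%:R + 1 :> F by rewrite -natrM natr1.
  rewrite ltr_pM2r ?(exprn_gt0 _ yq_gt0)//.
  have := ltr_pM2l q_gt0 m.+1%:R (q%:R * t ^+ 2); rewrite qt.
  have := mulr_gt0 q_gt0 t_gt0; nra.
rewrite -exprMn mulrC exprn_ile1// mulr_ge0 ?ltW//.
by rewrite addr_gt0// mulr_gt0.
Qed.

(** The Cauchy-Schwarz inequality against the constant sequence: [n] times the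
    difference of both sides is the sum of the squares [(n * x i - S) ^+ 2]. *)
Lemma sqr_sum_le (F : numDomainType) n (x : 'I_n -> F) :
  (forall i, x i \is Num.real) -> (\sum_i x i) ^+ 2 <= n%:R * \sum_i x i ^+ 2.
Proof.
case: n x => [|n] x xr; first by rewrite !big_ord0 expr0n mul0r.
set S := \sum_i x i; have S_real : S \is Num.real by exact: rpred_sum.
rewrite -(@ler_pM2l _ n.+1%:R) ?ltr0n// -subr_ge0.
suff -> : n.+1%:R * (n.+1%:R * (\sum_i x i ^+ 2)) - n.+1%:R * S ^+ 2 =
    \sum_i (n.+1%:R * x i - S) ^+ 2.
  apply: sumr_ge0 => i _; rewrite real_exprn_even_ge0//.
  by rewrite rpredB// rpredM// realn.
under [RHS]eq_bigr do rewrite sqrrB exprMn.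
rewrite !big_split/= sumrN sumr_const card_ord -mulr_sumr sumrMnl -mulr_suml -mulr_sumr -/S.
rewrite -[S ^+ 2 *+ _]mulr_natl; ring.
Qed.

(** * Bohr's approximation argument *)

Lemma norm1D_sqr (R : realType) (u : R[i]) :
  `|u| = 1 -> `|1 + u| ^+ 2 + `|u - 1| ^+ 2 = 4.
Proof.
move=> u1; have := sqr_normc u; rewrite u1 expr1n => uu.
rewrite !sqr_normc rmorphD rmorphB rmorph1 !(mulrDl, mulrDr, mulrBl, mulrBr).
rewrite -uu; ring.
Qed.

(** With [u_k = z_k ^+ n / a_k], failure of the conclusion bounds the square of
    the product of the [`|1 + u_k|] by [4 ^+ m * rho] with [rho < 1], for every
    [n].  The [p]-th power of the product is an exponential sum in [n] with the
    distinct frequencies [\prod_k z k ^+ j k] and binomial coefficients, whose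
    mean square is [S ^+ m], where [S] is the sum of the squares of the
    ['C(p, i)]; and [S >= 4 ^+ p / p.+1] by Cauchy-Schwarz.  The resulting bound
    [1 <= p.+1 ^+ m * rho ^+ p] fails for some [p]. *)
Lemma bohr_approximation (R : realType) m (z a : 'I_m -> R[i]) (e : R) :
  (forall k, `|z k| = 1) -> (forall k, `|a k| = 1) ->
  (forall p, injective (fun j : {ffun 'I_m -> 'I_p} => \prod_k z k ^+ j k)) ->
  0 < e -> exists n : nat, forall k, `|z k ^+ n - a k| < e%:C.
Proof.
move=> z1 a1 z_inj e_gt0; apply: contrapT => noapprox.
have far n : exists k, e%:C <= `|z k ^+ n - a k|.
  apply: contrapT => H; apply: noapprox; exists n => k.
  rewrite real_ltNge// ?complex_real//; apply/negP => ?; apply: H; by exists k.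
pose u n k := (a k)^* * z k ^+ n.
have u1 n k : `|u n k| = 1 by rewrite normrM normcJ a1 normrX z1 expr1n mulr1.
have uB n k : `|u n k - 1| = `|z k ^+ n - a k|.
  have ua : (a k)^* * a k = 1 by rewrite mulrC -sqr_normc a1 expr1n.
  by rewrite -[RHS]mul1r -[1 in RHS](a1 k) -(normcJ (a k)) -normrM mulrBr ua.
pose rho : R := 1 - e ^+ 2 / 4.
have norm1D_le n k : `|1 + u n k| ^+ 2 <= 4.
  by rewrite -(norm1D_sqr (u1 n k)) lerDl exprn_ge0.
have [k1 k1P] := far 0%N.
have norm1D_far n k : e%:C <= `|z k ^+ n - a k| -> `|1 + u n k| ^+ 2 <= 4 * rho%:C.
  move=> ek; have <- : 4 - (e%:C) ^+ 2 = 4 * rho%:C.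
    rewrite /rho rmorphB rmorphM rmorphXn rmorphV ?unitfE// rmorph1 rmorph_nat.
    by field.
  rewrite -(norm1D_sqr (u1 n k)) -addrA lerDl uB subr_ge0.
  by rewrite lerXn2r// nnegrE ?(lecR 0) ?ltW// .
have rho_ge0 : 0 <= rho.
  rewrite -(lecR 0) -(@pmulr_rge0 _ 4)//.
  by rewrite (le_trans _ (norm1D_far _ _ k1P))// exprn_ge0.
have rho_lt1 : rho < 1 by rewrite /rho gtrBl divr_gt0// exprn_gt0.
have prod_le n : `|\prod_k (1 + u n k)| ^+ 2 <= 4 ^+ m * rho%:C.
  (* One factor is at most [4 * rho], the others at most [4]. *)
  have [k0 k0P] := far n.
  rewrite normr_prod -prodrXl (bigD1 k0)//=.
  rewrite -[X in 4 ^+ X]card_ord -prodr_const [in leRHS](bigD1 k0)//= [leRHS]mulrAC.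
  apply: ler_pM; rewrite ?norm1D_far ?exprn_ge0//.
    by apply: prodr_ge0 => k _; exact: exprn_ge0.
  by apply: ler_prod => k _; rewrite exprn_ge0// norm1D_le.
have [p] := polynomial_times_geometric_lt1 m rho_ge0 rho_lt1.
apply/negP; rewrite -leNgt -(lecR 1) rmorphM !rmorphXn rmorph_nat rmorph1.
pose S : R[i] := \sum_(i < p.+1) 'C(p, i)%:R ^+ 2.
pose coef (f : {ffun 'I_m -> 'I_p.+1}) := \prod_k ('C(p, f k)%:R * (a k)^* ^+ f k).
have coef_sum : \sum_f `|coef f| ^+ 2 = S ^+ m.
  rewrite -[X in S ^+ X]card_ord -prodr_const bigA_distr_bigA/=.
  apply: eq_bigr => f _; rewrite normr_prod -prodrXl; apply: eq_bigr => k _.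
  by rewrite normrM normrX normcJ a1 expr1n mulr1 normr_nat.
have Sm : S ^+ m <= (4 ^+ m * rho%:C) ^+ p.
  rewrite -coef_sum; apply: (@mean_square_le _ _ _
    (fun f : {ffun 'I_m -> 'I_p.+1} => \prod_k z k ^+ f k)) => [f|f g|n].
  - rewrite normr_prod big1// => k _; by rewrite normrX z1 expr1n.
  - exact: z_inj.
  suff -> : \sum_f coef f * (\prod_k z k ^+ f k) ^+ n = (\prod_k (1 + u n k)) ^+ p.
    by rewrite normrX exprAC lerXn2r// nnegrE ?exprn_ge0// mulr_ge0 ?exprn_ge0// (lecR 0).
  rewrite -prodrXl; under [RHS]eq_bigr do rewrite exprDn.
  rewrite bigA_distr_bigA/=; apply: eq_bigr => f _.
  rewrite -prodrXl -big_split/=; apply: eq_bigr => k _.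
  by rewrite -[RHS]mulr_natl expr1n mul1r /u exprMn mulrA exprAC.
have S_ge : 4 ^+ p <= p.+1%:R * S.
  have -> : 4 ^+ p = (\sum_(i < p.+1) 'C(p, i)%:R) ^+ 2 :> R[i].
    have -> : \sum_(i < p.+1) 'C(p, i)%:R = 2 ^+ p :> R[i].
      rewrite -[2]/(1 + 1 :> R[i]) exprDn; apply: eq_bigr => i _.
      by rewrite !expr1n mul1r.
    by rewrite exprAC; congr (_ ^+ p); rewrite expr2 -natrM.
  by apply: sqr_sum_le => i; exact: realn.
have four_gt0 : 0 < 4 ^+ m ^+ p :> R[i] by rewrite !exprn_gt0.
rewrite -(ler_pM2l four_gt0) mulr1 mulrCA -exprMn.
apply: le_trans (ler_wpM2l _ Sm); last by rewrite exprn_ge0.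
rewrite -exprMn exprAC lerXn2r// nnegrE ?exprn_ge0//.
by rewrite (le_trans _ S_ge)// exprn_ge0.
Qed.

(** * The circle and Kronecker's theorem *)

Section Cis.
Variable R : realType.
Implicit Types (s t : R) (x y : circle R) (k : int).

Lemma cval_inj : injective (@cval R). Proof. exact: val_inj. Qed.

Lemma cvalX x n : cval (x ^+ n)%g = cval x ^+ n.
Proof. by elim: n => [|n IHn] //; rewrite expgS exprS /= IHn. Qed.

Lemma cval_expgz x k : cval (expgz x k) = cval x ^ k.
Proof. by case: k => n; rewrite /= cvalX. Qed.

Lemma cval_prod (I : finType) (F : I -> circle R) :
  cval (\prod_i F i)%g = \prod_i cval (F i).
Proof. by apply: (big_morph (@cval R)). Qed.

Lemma cisD s t : cis (s + t) = (cis s * cis t)%g.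
Proof. by apply: cval_inj; rewrite /= cosD sinD [X in _ +i* X]addrC. Qed.

Lemma cis0 : cis 0 = 1%g :> circle R.
Proof. by apply: cval_inj; rewrite /= cos0 sin0. Qed.

Lemma cisN t : cis (- t) = (cis t)^-1%g.
Proof. by apply: (mulgI (cis t)); rewrite -cisD subrr cis0 mulgV. Qed.

Lemma cisMn t n : cis (t * n%:R) = (cis t ^+ n)%g.
Proof.
elim: n => [|n IHn]; first by rewrite mulr0 cis0.
by rewrite -natr1 mulrDr mulr1 addrC cisD IHn expgS.
Qed.

Lemma cisMz t k : cis (t * k%:~R) = expgz (cis t) k.
Proof.
case: k => n /=; first by rewrite -cisMn.
by rewrite NegzE mulrNz mulrN cisN -cisMn.
Qed.

Lemma expgz1 (G : groupType) k : expgz (1%g : G) k = 1%g.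
Proof. by case: k => n; rewrite /expgz expg1n ?invg1. Qed.

Lemma cis_2piz k : cis (2 * pi * k%:~R) = 1%g :> circle R.
Proof.
rewrite cisMz; suff -> : cis (2 * pi) = 1%g :> circle R by rewrite expgz1.
by apply: cval_inj; rewrite /= mulr_natl cos2pi sin2pi.
Qed.

(** Reduce [t] modulo [2 pi] to [s] in [[0, 2 pi[].  Then
    [1 = cos s = 1 - 2 * sin (s / 2) ^+ 2], but [sin] is positive on
    []0, pi[], so [s] is [0]. *)
Lemma cis_eq1 t : cis t = 1%g -> exists k, t = 2 * pi * k%:~R.
Proof.
move=> t1; have pi2_gt0 : 0 < 2 * pi :> R by rewrite mulr_gt0// pi_gt0.
pose k := Num.floor (t / (2 * pi)); pose s := t - 2 * pi * k%:~R.
have s_ge0 : 0 <= s.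
  by rewrite subr_ge0 mulrC -ler_pdivlMr// floor_le.
have s_lt : s < 2 * pi.
  rewrite ltrBlDr -[X in X + _]mulr1 -mulrDr mulrC -ltr_pdivrMr// addrC.
  by rewrite -intrD1 floorD1_gt.
have s1 : cis s = 1%g by rewrite cisD cisN cis_2piz t1 invg1 mulg1.
exists k; apply/eqP; rewrite -subr_eq0 -/s; case: ltgtP s_ge0 => // s_gt0 _.
have /(congr1 (fun z : circle R => complex.Re (cval z))) /= := s1.
have -> : s = (s / 2) *+ 2 by rewrite -mulr_natr divfK.
rewrite cos_mulr2n cos2sin2 => cs.
have : sin (s / 2) = 0.
  apply/eqP; rewrite -sqrf_eq0; apply/eqP; move: cs.
  rewrite -mulr_natr; lra.
have : 0 < sin (s / 2) by apply: sin_gt0_pi; lra.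
lra.
Qed.

Lemma cis_surj x : exists2 t, - pi <= t <= pi & x = cis t.
Proof.
case: x => -[a b] ab1; have : a ^+ 2 + b ^+ 2 = 1.
  move: ab1 => /eqP; rewrite normc_def/= => /(congr1 (@complex.Re R)) /= ab.
  by rewrite -[LHS]sqr_sqrtr ?addr_ge0 ?sqr_ge0// ab expr1n.
move=> ab; have a_bound : -1 <= a <= 1 by apply/andP; split; nra.
have cosa : cos (acos a) = a by rewrite acosK// in_itv.
have acos_bound : 0 <= acos a <= pi by rewrite acos_ge0// acos_lepi.
have sina : sin (acos a) = `|b|.
  by rewrite sin_acos// -ab addrC addKr sqrtr_sqr.
have [b_ge0|b_lt0] := leP 0 b.
  exists (acos a); first lra.
  by apply: cval_inj; rewrite /= cosa sina ger0_norm.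
exists (- acos a); first lra.
by apply: cval_inj; rewrite /= cosN sinN cosa sina ltr0_norm// opprK.
Qed.

End Cis.

Lemma cis_sum (R : realType) (I : finType) (t : I -> R) :
  cis (\sum_i t i) = (\prod_i cis (t i))%g.
Proof. by apply: (big_morph (@cis R)); [exact: cisD | exact: cis0]. Qed.

(** Kronecker's theorem.  Two monomials in the [cis (theta k)] that take the same
    value give an integer combination of the [theta k] equal to a multiple of
    [2 pi], so freeness is the injectivity that Bohr's argument needs. *)
Lemma kronecker_approximation (R : realType) m (theta : 'I_m -> R)
    (alpha : torus R m) (e : R) :
  Qfree (fcons (2 * pi) theta) -> 0 < e ->
  exists n : nat, forall k,
    `|cval (cis (theta k) ^+ n)%g - cval (alpha k)| < e%:C.
Proof.
move=> free e_gt0.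
have [||p j j' jj'|//|n nP] := @bohr_approximation R m
    (fun k => cval (cis (theta k))) (fun k => cval (alpha k)) e.
- by move=> k; exact: circleP.
- by move=> k; exact: circleP.
- have cisE (i : {ffun 'I_m -> 'I_p}) :
      \prod_k cval (cis (theta k)) ^+ i k = cval (cis (\sum_k theta k * (i k)%:R)).
    by rewrite cis_sum cval_prod; apply: eq_bigr => k _; rewrite cisMn cvalX.
  have /cis_eq1[l lE] : cis (\sum_k theta k * (j k)%:R - \sum_k theta k * (j' k)%:R) = 1%g.
    rewrite cisD cisN; suff -> : cis (\sum_k theta k * (j k)%:R) =
      cis (\sum_k theta k * (j' k)%:R) by rewrite mulgV.
    by apply: cval_inj; rewrite -!cisE.
  pose q (i : 'I_m.+1) : rat := oapp (fun k => (j k)%:R - (j' k)%:R) (- l%:~R) (unlift ord0 i).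
  have /free q0 : \sum_i ratr (q i) * fcons (2 * pi) theta i = 0.
    rewrite big_ord_recl /q /fcons unlift_none /=.
    under eq_bigr do rewrite liftK /= rmorphB !rmorph_nat mulrC mulrBr.
    by rewrite sumrB lE rmorphN rmorph_int mulNr mulrC addNr.
  apply/ffunP => k; apply/val_inj/eqP; rewrite -(eqr_nat rat) -subr_eq0.
  by have := q0 (lift ord0 k); rewrite /q liftK /= => ->.
by exists n => k; rewrite cvalX; exact: nP.
Qed.

(** * Topology of the torus *)

Section CplxTopology.
Variable R : realType.
Local Notation C := (Cplx R).

Lemma normc_le_ReIm (z : R[i]) : `|z| <= (`|complex.Re z| + `|complex.Im z|)%:C.
Proof.
rewrite [z in `|z|]complexE (le_trans (ler_normD _ _))// normrM rmorphD.
have -> : `|'i%C| = 1 :> R[i] by rewrite normc_def/= expr0n add0r expr1n sqrtr1.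
by rewrite mul1r !normc_def/= expr0n !addr0 !sqrtr_sqr.
Qed.

Lemma normc_ge_Im (z : R[i]) : `|complex.Im z|%:C <= `|z|.
Proof. by rewrite normc_def lecR -sqrtr_sqr ler_wsqrtr// lerDr sqr_ge0. Qed.

Lemma Re_continuous : continuous (fun z : C => complex.Re z : R).
Proof.
move=> z; have FF := nbhs_filter z; apply/cvgrPdist_lt => e e_gt0.
apply/nbhs_ballP; exists e%:C => [/=|w zw]; first by rewrite ltcR.
by rewrite /= -raddfB -ltcR (le_lt_trans (normc_ge_Re _)).
Qed.

Lemma Im_continuous : continuous (fun z : C => complex.Im z : R).
Proof.
move=> z; have FF := nbhs_filter z; apply/cvgrPdist_lt => e e_gt0.
apply/nbhs_ballP; exists e%:C => [/=|w zw]; first by rewrite ltcR.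
by rewrite /= -raddfB -ltcR (le_lt_trans (normc_ge_Im _)).
Qed.

Lemma Cplx_cvg (T : Type) (F : set_system T) (f : T -> C) (l : C) : Filter F ->
  (fun x => complex.Re (f x) : R) @ F --> (complex.Re l : R) ->
  (fun x => complex.Im (f x) : R) @ F --> (complex.Im l : R) ->
  f @ F --> l.
Proof.
move=> FF fRe fIm; apply/cvgrPdist_lt => e; rewrite ltcE => /andP[/eqP/= eIm eRe].
have eE : e = (complex.Re e / 2 + complex.Re e / 2)%:C.
  by rewrite -splitr; apply/eqP; rewrite eq_complex/= eqxx -eIm eqxx.
have e2_gt0 : 0 < complex.Re e / 2 by rewrite divr_gt0.
near=> x; rewrite (le_lt_trans (normc_le_ReIm _))// eE ltcR !raddfB ltrD//; near: x.
  by move/cvgrPdist_lt : fRe; apply.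
by move/cvgrPdist_lt : fIm; apply.
Unshelve. all: by end_near. Qed.

End CplxTopology.

Section TorusTopology.
Variables (R : realType) (n : nat).
Local Notation T := (torus R n).

(** The balls of the sup distance on the torus, which is invariant under
    translations; they are a basis of neighbourhoods. *)
Definition torus_close (e : R) (x y : T) :=
  forall k, `|cval (x k) - cval (y k)| < e%:C.

Lemma torus_close_mull e (z x y : T) :
  torus_close e x y -> torus_close e (z * x)%g (z * y)%g.
Proof. by move=> xy k; rewrite /= -mulrBr normrM circleP mul1r; exact: xy. Qed.

Lemma near_torus_close (x : T) (e : R) : 0 < e -> \forall y \near x, torus_close e x y.
Proof.
move=> e_gt0; have FF := nbhs_filter x.
apply: (@filter_forall _ _ (fun k (y : T) => `|cval (x k) - cval (y k)| < e%:C) _ FF) => k.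
have /cvgrPdist_lt/(_ e%:C) : (fun y : T => cval (y k)) @ x --> cval (x k).
  apply: (@continuous_comp _ _ _ (fun y : T => y k) (@cval R)).
    exact: torus_coord_continuous.
  exact: cval_continuous.
by apply; rewrite ltcR.
Qed.

(** The filter generated by the balls around [x] converges to [x] in the product
    topology because it does so in each coordinate. *)
Lemma nbhs_torus_close (x : T) (U : set T) :
  nbhs x U -> exists2 e : R, 0 < e & torus_close e x `<=` U.
Proof.
pose B := filter_from [set e : R | 0 < e] (fun e => torus_close e x).
have FB : Filter B.
  apply: filter_from_filter; first by exists 1 => /=.
  move=> e1 e2 /= e1_gt0 e2_gt0; exists (Num.min e1 e2); first by rewrite lt_min e1_gt0.
  by move=> y xy; split=> k; rewrite (lt_le_trans (xy k))// lecR ge_min lexx ?orbT.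
have Bx : B --> x.
  apply: (snd (@cvg_sup _ _ (fun i : 'I_n => Topological.class
    (initial_topology (fun g : (forall i : 'I_n, circle R) => g i))) B x FB)) => k.
  move=> V [W [[W' W'open <-]] /= Wx WV].
  have [W2 W2open W2E] := W'open.
  have : nbhs (cval (x k)) W2.
    by apply: open_nbhs_nbhs; split=> //; move: Wx; rewrite -W2E.
  move=> /nbhs_ballP[d /= d_gt0 dW2]; exists (complex.Re d).
    by move: d_gt0; rewrite ltcE => /andP[].
  move=> y xy; apply: WV; rewrite -W2E; apply: dW2.
  rewrite /ball/=; have := xy k.
  by rewrite RRe_real// ger0_real// ltW.
by move=> /Bx.
Qed.

Lemma torus_mulC (x y : T) : (x * y)%g = (y * x)%g.
Proof. by apply/funext => k; apply: val_inj; rewrite /= mulrC. Qed.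

(** The circle is the image of [`[- pi, pi]] under the continuous map [cis]. *)
Lemma circle_compact : compact [set: circle R].
Proof.
have -> : [set: circle R] = @cis R @` `[- pi, pi].
  apply/seteqP; split => // x _; have [t tpi ->] := cis_surj x.
  by exists t => //=; rewrite in_itv.
apply: continuous_compact; last exact: segment_compact.
apply: continuous_subspaceT; apply: continuous_comp_initial => t.
by apply: Cplx_cvg => /=; [exact: continuous_cos | exact: continuous_sin].
Qed.

Lemma torus_compact : compact [set: T].
Proof.
have -> : [set: T] = [set f : 'I_n -> circle R | forall i, [set: circle R] (f i)].
  by apply/seteqP; split.
by apply: (@tychonoff _ (fun=> circle R) (fun=> setT)) => _; exact: circle_compact.
Qed.

Lemma torus_hausdorff : hausdorff_space T.
Proof.
move=> x y xy; apply/funext => k; apply/cval_inj/eqP.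
rewrite -subr_eq0 -normr_le0; apply/negPn/negP.
rewrite -real_ltNge ?realE ?normr_ge0 ?lexx// => xy_gt0.
set e := complex.Re `|cval (x k) - cval (y k)|.
have eE : e%:C = `|cval (x k) - cval (y k)| by rewrite RRe_real// ger0_real// ltW.
have e2_gt0 : 0 < e / 2 by rewrite divr_gt0// -(@ltcR _ 0) eE.
have [z [/(_ k) xz /(_ k) yz]] :=
  xy _ _ (near_torus_close x e2_gt0) (near_torus_close y e2_gt0).
have := ler_distD (cval (z k)) (cval (x k)) (cval (y k)).
rewrite -eE => e_le; suff : e%:C < e%:C by rewrite ltxx.
by rewrite (le_lt_trans e_le)// [e]splitr rmorphD ltrD// distrC.
Qed.

(** Heine's theorem, from the near-covering form of compactness applied to the
    family indexed by the radius [d], as [d] tends to [0] from above. *)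
Lemma uniformly_continuous_on_torus (g : T -> R) : continuous g ->
  forall e, 0 < e -> exists2 delta : R, 0 < delta &
    forall x y, torus_close delta x y -> `|g x - g y| < e.
Proof.
move=> g_cont e e_gt0; have e2_gt0 : 0 < e / 2 by rewrite divr_gt0.
have := torus_compact; rewrite compact_near_coveringP => cov.
have := cov R (0^'+) (fun d x => forall y, torus_close d x y -> `|g x - g y| < e).
have H (x : T) : [set: T] x -> \forall x' \near x & d \near (0 : R)^'+,
    forall y, torus_close d x' y -> `|g x' - g y| < e.
  move=> _; have /cvgrPdist_lt/(_ _ e2_gt0)/nbhs_torus_close[d d_gt0 dP] := g_cont x.
  have d2_gt0 : 0 < d / 2 by rewrite divr_gt0.
  exists (torus_close (d / 2) x, [set r | r < d / 2]) => /=.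
    split; first exact: near_torus_close.
    exact: nbhs_right_lt.
  move=> [x' r] /= [xx' r_lt] y x'y.
  rewrite [e]splitr -(subrKA (g x)) (le_lt_trans (ler_normD _ _))// ltrD//.
    rewrite distrC; apply: dP => k; rewrite (lt_le_trans (xx' k))// lecR.
    by rewrite ler_pdivrMr// ler_pMr// ler1n.
  apply: dP => k; rewrite (le_lt_trans (ler_distD (cval (x' k)) _ _))//.
  rewrite [d]splitr rmorphD ltrD// (lt_trans (x'y k))// ltcR//.
move=> /(_ _ H) near0; have /filter_ex : \forall d \near (0 : R)^'+, 0 < d /\
    forall x y, torus_close d x y -> `|g x - g y| < e.
  near=> d; split; first by near: d; exact: nbhs_right_gt.
  move=> x y; apply: (near near0 d) => //; near: d; exact: near0.
by case=> d [d_gt0 dP]; exists d.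
Unshelve. all: by end_near. Qed.

End TorusTopology.

(** * Orbit averages on the torus *)

Section TorusIntegral.
Variables (R : realType) (n : nat).
Local Notation T := (torus R n).
Implicit Types g : T -> R.

Lemma continuous_borel_measurable g (D : set (borel T)) :
  continuous g -> measurable D -> measurable_fun D (g : borel T -> R).
Proof.
move=> /continuousP g_cont mD; apply: measurable_funS (@subsetT _ D) _ => //.
apply: (measurability _ (RGenOpens.measurableE R)).
move=> _ [_ [a [b ->] <-]]; rewrite setTI; apply: sub_sigma_algebra.
exact/g_cont/interval_open.
Qed.

Lemma continuous_torus_bounded g : continuous g -> exists M, forall x, `|g x| <= M.
Proof.
move=> g_cont; have /compact_bounded[M [_ MP]] : compact (g @` [set: T]).
  by apply: continuous_compact; [exact: continuous_subspaceT | exact: torus_compact].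
exists (M + 1) => x; apply: (MP (M + 1)); first by rewrite ltrDl.
by exists x.
Qed.

Variable mu : {measure set (borel T) -> \bar R}.
Hypothesis mu1 : mu setT = 1%E.

Lemma continuous_integrable g (D : set (borel T)) :
  continuous g -> measurable D -> mu.-integrable D (EFin \o g).
Proof.
move=> g_cont mD; apply: measurable_bounded_integrable => //.
- apply: (@le_lt_trans _ _ (mu setT)); first by rewrite le_measure ?inE.
  by rewrite mu1 ltry.
- exact: continuous_borel_measurable.
have [M MP] := continuous_torus_bounded g_cont.
by exists M; split => [|B MB x _]; [exact: num_real | exact: le_trans (MP x) (ltW MB)].
Qed.

(** Averages are compared on a set of full measure only, whereas invariance
    is used on the whole torus. *)
Lemma Rintegral_full_measure g (D : set (borel T)) : continuous g ->
  measurable D -> mu D = 1%E -> Rintegral mu D g = Rintegral mu setT g.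
Proof.
move=> g_cont mD muD; congr fine.
rewrite [RHS](@negligible_integral _ _ _ _ _ (~` D))//.
- by rewrite setDE setCK setTI.
- exact: measurableC.
- exact: continuous_integrable.
- have : (mu D + mu (~` D))%E = (1 + 0)%E.
    rewrite adde0 -mu1 -[in RHS](setUv D); apply/esym.
    by apply: measureU => //; [exact: measurableC | rewrite setICr].
  rewrite muD; case: (mu (~` D)) => [r| |] //=.
  by rewrite -!EFinD => -[/addrI ->].
Qed.

Variable nu : T.
Hypothesis mu_inv : forall A : set (borel T), measurable A -> mu (translate nu @^-1` A) = mu A.

Lemma Rintegral_translate g : continuous g ->
  Rintegral mu setT (fun x => g (nu * x)%g) = Rintegral mu setT g.
Proof.
move=> g_cont; congr fine.
transitivity (\int[pushforward mu (translate nu)]_(x in setT) (g x)%:E)%E; last first.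
  by apply: eq_measure_integral => A mA _; exact: mu_inv.
have gnu_cont : continuous (fun x : T => g (nu * x)%g).
  by move=> x; apply: continuous_comp; [exact: torus_mul_continuous | exact: g_cont].
rewrite integral_pushforward ?preimage_setT//.
- by apply/measurable_EFinP; exact: continuous_borel_measurable.
- exact: continuous_integrable gnu_cont _.
Qed.

(** The exponents start at [1], as the orbit averages run over positive
    integers. *)
Definition birkhoff_sum g N (y : T) := \sum_(k < N) g (nu ^+ k.+1 * y)%g.

Lemma birkhoff_sum0 g : birkhoff_sum g 0 = fun=> 0.
Proof. by apply/funext => y; rewrite /birkhoff_sum big_ord0. Qed.

Lemma birkhoff_sumS g N :
  birkhoff_sum g N.+1 = fun y => birkhoff_sum g N y + g (nu ^+ N.+1 * y)%g.
Proof. by apply/funext => y; rewrite /birkhoff_sum big_ord_recr. Qed.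

Lemma birkhoff_sum_continuous g N : continuous g -> continuous (birkhoff_sum g N).
Proof.
move=> g_cont; elim: N => [|N IHN] y.
  rewrite birkhoff_sum0. exact: (@cst_continuous T R 0 y).
rewrite birkhoff_sumS; apply: (@cvgD _ _ _ (nbhs y)); first exact: IHN.
by apply: (@continuous_comp _ _ _ (fun y : T => (nu ^+ N.+1 * y)%g) g);
  [exact: torus_mul_continuous | exact: g_cont].
Qed.

Lemma Rintegral_birkhoff_sum g N : continuous g ->
  Rintegral mu setT (birkhoff_sum g N) = N%:R * Rintegral mu setT g.
Proof.
move=> g_cont; elim: N => [|N IHN].
  by rewrite mul0r birkhoff_sum0 Rintegral_cst// mul0r.
have gX_cont k : continuous (fun y : T => g (nu ^+ k * y)%g).
  by move=> x; apply: continuous_comp; [exact: torus_mul_continuous | exact: g_cont].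
have gX k : Rintegral mu setT (fun y => g (nu ^+ k * y)%g) = Rintegral mu setT g.
  elim: k => [|k IHk]; first by apply: eq_Rintegral => x _; rewrite mul1g.
  rewrite -[RHS]IHk -[RHS]Rintegral_translate//.
  by apply: eq_Rintegral => x _; rewrite mulgA expgSr.
rewrite -natr1 mulrDl mul1r -IHN -(gX N.+1) birkhoff_sumS RintegralD//.
- by apply: continuous_integrable => //; exact: birkhoff_sum_continuous.
- exact: continuous_integrable.
Qed.

(** Shifting the starting point by [nu] drops the first term and adds a new last
    one. *)
Lemma birkhoff_sum_shift g M j N : (forall x, `|g x| <= M) ->
  `|birkhoff_sum g N (nu ^+ j)%g - birkhoff_sum g N 1%g| <= j%:R * (2 * M).
Proof.
move=> gM; elim: j => [|j IHj]; first by rewrite subrr normr0 mul0r.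
rewrite -natr1 mulrDl mul1r -(subrKA (birkhoff_sum g N (nu ^+ j)%g)) addrC.
rewrite (le_trans (ler_normD _ _))// lerD//.
have -> : birkhoff_sum g N (nu ^+ j.+1)%g - birkhoff_sum g N (nu ^+ j)%g =
    g (nu ^+ (N + j).+1)%g - g (nu ^+ j.+1)%g.
  elim: N {IHj} => [|N IHN]; first by rewrite birkhoff_sum0 !subrr.
  rewrite birkhoff_sumS.
  by rewrite opprD addrACA IHN -!expgnDr addrC addnS !addSn subrKA.
by rewrite (le_trans (ler_normB _ _))// mulr2n mulrDl mul1r lerD.
Qed.

Lemma birkhoff_sum_close g delta e N (x y : T) :
  (forall x y, torus_close delta x y -> `|g x - g y| < e) ->
  torus_close delta x y -> `|birkhoff_sum g N x - birkhoff_sum g N y| <= N%:R * e.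
Proof.
move=> g_unif xy; rewrite /birkhoff_sum -sumrB (le_trans (ler_norm_sum _ _ _))//.
rewrite -[X in X%:R * _]card_ord mulr_natl -sumr_const; apply: ler_sum => k _.
by rewrite ltW// g_unif//; exact: torus_close_mull.
Qed.

Variable G : set T.
Hypothesis G_compact : compact G.
Hypothesis G_dense : forall y, G y -> forall e, 0 < e ->
  exists j : nat, torus_close e y (nu ^+ j)%g.

(** Given [y] in [G], some [nu ^+ j] is so close to the points near [y] that
    uniform continuity makes the two sums differ by at most [N * (e / 2)],
    while the sums from [nu ^+ j] and [1] differ by a constant, which is at most
    [N * (e / 2)] for large [N].  Compactness of [G] makes the threshold on [N]
    independent of [y]. *)
Lemma birkhoff_sum_uniform g e : continuous g -> 0 < e ->
  \forall N \near \oo, forall y, G y ->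
    `|birkhoff_sum g N 1%g - birkhoff_sum g N y| <= N%:R * e.
Proof.
move=> g_cont e_gt0; have e2_gt0 : 0 < e / 2 by rewrite divr_gt0.
have [M gM] := continuous_torus_bounded g_cont.
have [delta delta_gt0 g_unif] := uniformly_continuous_on_torus g_cont e2_gt0.
have delta2_gt0 : 0 < delta / 2 by rewrite divr_gt0.
have /compact_near_coveringP cov := G_compact.
have := cov _ \oo (fun N y => `|birkhoff_sum g N 1%g - birkhoff_sum g N y| <= N%:R * e).
move=> /(_ _); apply => y /G_dense/(_ _ delta2_gt0)[j yj].
exists (torus_close (delta / 2) y, [set N | j%:R * (2 * M) <= N%:R * (e / 2)]) => /=.
  split; first exact: near_torus_close.
  have : \forall N \near \oo, j%:R * (2 * M) / (e / 2) <= (N%:R : R) by exact: nbhs_infty_ger.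
  by apply: filterS => N; rewrite ler_pdivrMr.
move=> [y' N] /= [yy' jN]; rewrite -(subrKA (birkhoff_sum g N (nu ^+ j)%g)).
rewrite (le_trans (ler_normD _ _))// [e]splitr mulrDr lerD//.
  by rewrite distrC (le_trans _ jN)// birkhoff_sum_shift.
apply: birkhoff_sum_close g_unif _ => k.
rewrite (le_lt_trans (ler_distD (cval (y k)) _ _))//.
by rewrite [delta]splitr rmorphD ltrD// distrC.
Qed.

Hypothesis mG : measurable (G : set (borel T)).
Hypothesis muG : mu G = 1%E.

(** Averaging the uniform estimate over the starting point replaces the sum from
    [y] by [N] times the integral.  The factor [X^-1] instead of [N^-1], with [N] the
    integer part of [X], costs at most [`|I| / X]. *)
Lemma birkhoff_average_cvg g : continuous g ->
  (fun X : R => X^-1 * birkhoff_sum g (Num.truncn X) 1%g) @ +oo -->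
  Rintegral mu G g.
Proof.
move=> g_cont; set I := Rintegral mu G g.
have avg N e : (forall y, G y -> `|birkhoff_sum g N 1%g - birkhoff_sum g N y| <= N%:R * e) ->
    `|birkhoff_sum g N 1%g - N%:R * I| <= N%:R * e.
  move=> Ne; have S_cont := @birkhoff_sum_continuous _ N g_cont.
  have -> : birkhoff_sum g N 1%g - N%:R * I =
      Rintegral mu G (fun y => birkhoff_sum g N 1%g - birkhoff_sum g N y).
    rewrite RintegralB//; last exact: continuous_integrable.
      rewrite Rintegral_cst// muG mulr1 !Rintegral_full_measure//.
      by rewrite Rintegral_birkhoff_sum// /I Rintegral_full_measure.
    by apply: continuous_integrable => //; exact: cst_continuous.
  have D_cont : continuous (fun y : T => birkhoff_sum g N 1%g - birkhoff_sum g N y).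
    move=> y; apply: (@cvgB _ _ _ (nbhs y)); last exact: S_cont.
    exact: (@cst_continuous T R _ y).
  have N_cont : continuous (fun y : T => `|birkhoff_sum g N 1%g - birkhoff_sum g N y|).
    move=> y; apply: (@continuous_comp T R R
      (fun y => birkhoff_sum g N 1%g - birkhoff_sum g N y) (fun z : R => `|z| : R)).
      exact: D_cont.
    exact: (@norm_continuous R R).
  rewrite (le_trans (le_normr_Rintegral _ _))//; first exact: continuous_integrable.
  have -> : N%:R * e = Rintegral mu G (fun=> N%:R * e) by rewrite Rintegral_cst// muG mulr1.
  apply: le_Rintegral => //.
    exact: continuous_integrable N_cont mG.
  by apply: continuous_integrable => //; exact: cst_continuous.
apply/cvgrPdist_le => e e_gt0; have e2_gt0 : 0 < e / 2 by rewrite divr_gt0.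
have [N0 _ N0P] := birkhoff_sum_uniform g_cont e2_gt0.
near=> X; have X_gt0 : 0 < X by near: X; exact: nbhs_pinfty_gt.
set N := Num.truncn X.
have N0N : (N0 <= N)%N.
  rewrite /N truncn_ge_nat ?ltW//; near: X; exact: nbhs_pinfty_ge.
have /andP[NX XN] : N%:R <= X < N.+1%:R by exact: truncn_itv (ltW _).
rewrite -(ler_pM2l X_gt0) -[X in X * `|_|]gtr0_norm// -normrM mulrBr mulrA divff ?gt_eqF// mul1r.
rewrite -(subrKA (N%:R * I)) (le_trans (ler_normD _ _))//.
rewrite [e]splitr mulrDr lerD//; last first.
  by rewrite distrC (le_trans (avg _ _ (N0P _ N0N)))// ler_wpM2r// ltW.
rewrite -mulrBl normrM ger0_norm ?subr_ge0//.
rewrite (@le_trans _ _ `|I|)//.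
  by rewrite ler_piMl// lerBlDl natr1 ltW.
by rewrite -ler_pdivrMr//; near: X; exact: nbhs_pinfty_ge.
Unshelve. all: by end_near. Qed.

End TorusIntegral.

(** * The parametrization of the subgroup *)

Lemma lcm_denoms_gt0 m s (c : 'I_s -> rat) (b : 'I_m -> 'I_s -> rat) :
  (0 < lcm_denoms c b)%N.
Proof.
have den_gt0 q : (0 < `|denq q|)%N by rewrite absz_gt0 denq_neq0.
have lcm_gt0 (I : finType) (F : I -> nat) :
    (forall i, 0 < F i)%N -> (0 < \big[lcmn/1%N]_i F i)%N.
  move=> F_gt0; apply: (big_ind (fun x => (0 < x)%N)) => // x y x0 y0.
  by rewrite lcmn_gt0 x0.
by apply: (lcm_gt0) => j; rewrite lcmn_gt0 den_gt0/=; exact: lcm_gt0.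
Qed.

Lemma lcm_denomsM_int m s (c : 'I_s -> rat) (b : 'I_m -> 'I_s -> rat) j :
  exists q : int, (lcm_denoms c b)%:R * c j = q%:~R.
Proof.
have /dvdnP[e ->] : (`|denq (c j)| %| lcm_denoms c b)%N.
  rewrite /lcm_denoms (bigD1 j)//=; apply: dvdn_trans (dvdn_lcml _ _).
  exact: dvdn_lcml.
exists (e%:Z * numq (c j)); rewrite natrM -mulrA intrM; congr (_ * _).
by rewrite numqE mulrC -absz_denq.
Qed.

Lemma Cplx_exp_continuous (R : realType) n : continuous (fun x : Cplx R => x ^+ n).
Proof.
elim: n => [|n IHn] x.
  exact: (@cst_continuous (Cplx R) (Cplx R) 1 x).
have -> : (fun y : Cplx R => y ^+ n.+1) = fun y => y * y ^+ n.
  by apply/funext => y; rewrite exprS.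
by apply: (@cvgM _ _ (nbhs x)); [exact: cvg_id | exact: IHn].
Qed.

Section Hparam.
Variables (R : realType) (m s : nat) (d : nat) (h : 'I_m -> 'I_s -> int).
Local Notation H_param := (@H_param R m s d h).

Lemma H_param_lshift z k : H_param z (lshift s k) = (z k ^+ d)%g.
Proof. by rewrite /Defs.H_param -[lshift s k]/(unsplit (inl k)) unsplitK. Qed.

Lemma H_param_rshift z j : H_param z (rshift m j) = (\prod_k expgz (z k) (h k j))%g.
Proof. by rewrite /Defs.H_param -[rshift m j]/(unsplit (inr j)) unsplitK. Qed.

Lemma H_paramM z w : H_param (z * w)%g = (H_param z * H_param w)%g.
Proof.
apply/funext => i; apply: cval_inj => /=; rewrite -(splitK i).
case: (fintype.split i) => j /=.
  by rewrite !H_param_lshift !cvalX /= exprMn.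
rewrite !H_param_rshift !cval_prod -big_split; apply: eq_bigr => k _ /=.
by rewrite !cval_expgz /= expfzMl.
Qed.

Lemma H_param1 : H_param 1%g = 1%g.
Proof.
by apply: (mulgI (H_param 1%g)); rewrite -H_paramM !mulg1.
Qed.

Lemma H_paramV z : H_param z^-1%g = (H_param z)^-1%g.
Proof. by apply: (mulgI (H_param z)); rewrite -H_paramM !mulgV H_param1. Qed.

(** The coordinates of the parametrization, as complex-valued functions; negative
    exponents are harmless since points of the circle are nonzero. *)
Lemma cval_prodX_continuous (J : Type) (r : seq J) (p : J -> 'I_m) (q : J -> int) :
  continuous (fun z : torus R m => \prod_(k <- r) cval (z (p k)) ^ q k : Cplx R).
Proof.
have coord_cont k : continuous (fun z : torus R m => cval (z k) : Cplx R).
  move=> z; apply: (@continuous_comp _ _ _ (fun z : torus R m => z k) (@cval R)).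
    exact: torus_coord_continuous.
  exact: cval_continuous.
elim: r => [|k r IHr].
  have -> : (fun z : torus R m => \prod_(k <- [::]) cval (z (p k)) ^ q k : Cplx R) = cst 1.
    by apply/funext => z; rewrite big_nil.
  exact: cst_continuous.
have -> : (fun z : torus R m => \prod_(j <- k :: r) cval (z (p j)) ^ q j : Cplx R) =
    fun z => (cval (z (p k)) ^ q k) * \prod_(j <- r) cval (z (p j)) ^ q j.
  by apply/funext => z; rewrite big_cons.
move=> z; apply: (@cvgM _ _ (nbhs z)); last exact: IHr.
case: (q k) => n /=.
  by apply: (@continuous_comp _ _ _ (fun z : torus R m => cval (z (p k)) : Cplx R)
    (fun x : Cplx R => x ^+ n)); [exact: coord_cont | exact: Cplx_exp_continuous].
apply: (@cvgV _ _ (nbhs z)); first by rewrite expf_neq0// cval_neq0.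
by apply: (@continuous_comp _ _ _ (fun z : torus R m => cval (z (p k)) : Cplx R)
  (fun x : Cplx R => x ^+ n.+1)); [exact: coord_cont | exact: Cplx_exp_continuous].
Qed.

Lemma H_param_continuous : continuous H_param.
Proof.
apply: (@prod_topology_continuous _ (fun=> circle R)) => i.
apply: continuous_comp_initial; rewrite -(splitK i).
case: (fintype.split i) => j /=.
  have -> : @cval R \o (fun z => H_param z (lshift s j)) =
      (fun z : torus R m => \prod_(k <- [:: tt]) cval (z j) ^ (d : int)).
    by apply/funext => z /=; rewrite H_param_lshift cvalX big_seq1.
  exact: (@cval_prodX_continuous unit [:: tt] (fun=> j) (fun=> Posz d)).
have -> : @cval R \o (fun z => H_param z (rshift m j)) =
    (fun z : torus R m => \prod_(k : 'I_m) cval (z k) ^ (h k j)).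
  apply/funext => z /=; rewrite H_param_rshift cval_prod.
  by apply: eq_bigr => k _; rewrite cval_expgz.
exact: (@cval_prodX_continuous _ _ id (h^~ j)).
Qed.

End Hparam.

(** * The union of the cosets and its measure *)

Section TorusPowers.
Variables (R : realType) (n : nat).
Local Notation T := (torus R n).

Lemma torusXE (x : T) a k : (x ^+ a)%g k = (x k ^+ a)%g.
Proof. by elim: a => [|a IHa] //; rewrite !expgS -IHa. Qed.

Lemma torus_expgzE (x : T) (q : int) k : expgz x q k = expgz (x k) q.
Proof.
case: q => a /=; first exact: torusXE.
by rewrite -[LHS]/((x ^+ a.+1)%g k)^-1%g torusXE.
Qed.

Lemma torus_point_intE (theta : 'I_n -> R) (X : int) :
  torus_point theta X%:~R = expgz (nu_theta theta) X.
Proof. by apply/funext => k; rewrite torus_expgzE /torus_point cisMz. Qed.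

Lemma torus_point_natE (theta : 'I_n -> R) (X : nat) :
  torus_point theta X%:R = (nu_theta theta ^+ X)%g.
Proof. exact: (torus_point_intE theta X). Qed.

Lemma closed_borel_measurable (A : set T) : closed A -> measurable (A : set (borel T)).
Proof.
by rewrite -openC => oA; rewrite -[A]setCK; apply: measurableC; exact: sub_sigma_algebra.
Qed.

End TorusPowers.

Section CosetUnion.
Variables (R : realType) (n : nat).
Local Notation T := (torus R n).
Variables (nu : T) (H : set T) (d : nat).
Hypothesis d_gt0 : (0 < d)%N.
Hypothesis H1 : H 1%g.
Hypothesis HM : forall x y, H x -> H y -> H (x * y)%g.
Hypothesis HV : forall x, H x -> H x^-1%g.
Hypothesis nudH : H (nu ^+ d)%g.

(** The exponent is limited to [a < d], but since [nu ^+ d] lies in [H] all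
    natural exponents give the same set ([coset_unionP]); negative powers
    are reached through [nu ^- a = nu ^+ (a d - a) * (nu ^+ d) ^- a]
    ([coset_union_inv]). *)
Definition coset_union : set T := \bigcup_(a < d) [set (nu ^+ a * z)%g | z in H].

Lemma coset_unionP y : coset_union y <-> exists a : nat, exists2 z, H z & y = (nu ^+ a * z)%g.
Proof.
split=> [[a _ [z Hz <-]]|[a [z Hz ->]]]; first by exists a, z.
exists (a %% d)%N; first by rewrite /= ltn_pmod.
exists ((nu ^+ d) ^+ (a %/ d) * z)%g; last first.
  by rewrite mulgA -expgnA -expgnDr mulnC addnC -divn_eq.
apply: HM => //; elim: (a %/ d)%N => // k IHk; rewrite expgS; exact: HM.
Qed.

Lemma coset_union_mul x y : coset_union x -> coset_union y -> coset_union (x * y)%g.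
Proof.
move=> /coset_unionP[a [z Hz ->]] /coset_unionP[a' [z' Hz' ->]].
apply/coset_unionP; exists (a + a')%N, (z * z')%g; first exact: HM.
by rewrite expgnDr !mulgA -[(_ * z * _)%g]mulgA [(z * _)%g]torus_mulC !mulgA.
Qed.

Lemma coset_unionX a : coset_union (nu ^+ a)%g.
Proof. by apply/coset_unionP; exists a, 1%g; rewrite ?mulg1. Qed.

Lemma coset_union_sub : H `<=` coset_union.
Proof. by move=> z Hz; apply/coset_unionP; exists 0, z; rewrite ?mul1g. Qed.

Lemma coset_union_inv x : coset_union x -> coset_union x^-1%g.
Proof.
move=> /coset_unionP[a [z Hz ->]].
have -> : (nu ^+ a * z)^-1%g = (nu ^+ (a * d - a) * (((nu ^+ d) ^+ a)^-1 * z^-1))%g.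
  have -> : (nu ^+ (a * d - a) = nu ^+ d ^+ a / nu ^+ a)%g.
    by rewrite expgnFr ?leq_pmulr// mulnC expgnA.
  by rewrite mulgA [(_ * (_ ^+ a)^-1)%g]torus_mulC mulgA mulVg mul1g invgM torus_mulC.
apply: coset_union_mul; first exact: coset_unionX.
apply: coset_union_sub; apply: HM; apply: HV => //.
by elim: a => // k IHk; rewrite expgS; exact: HM.
Qed.

Lemma coset_union_subgroup : is_subgroup coset_union.
Proof.
split; first exact: coset_union_sub.
by move=> x y xU yU; apply: coset_union_mul => //; exact: coset_union_inv.
Qed.

Lemma coset_unionXz q : coset_union (expgz nu q).
Proof.
by case: q => a; [exact: coset_unionX | exact/coset_union_inv/coset_unionX].
Qed.

Lemma coset_union_generated : coset_union = set_mul (generated [set nu]) H.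
Proof.
apply/seteqP; split=> y.
  move=> [a _ [z Hz <-]]; exists (nu ^+ a)%g; last by exists z.
  move=> K [[K1 KF] nuK]; have nuK' : K nu by exact: nuK.
  have KV x : K x -> K x^-1%g by move=> Kx; rewrite -div1g; exact: KF.
  elim: a => // k IHk; rewrite expgS -[(nu ^+ k)%g]invgK.
  by apply: KF => //; exact: KV.
move=> [x xgen [z Hz <-]]; apply: coset_union_mul; last exact: coset_union_sub.
by apply: xgen; split; [exact: coset_union_subgroup | move=> _ ->; exact: (coset_unionX 1)].
Qed.

Lemma coset_union_compact : compact H -> compact coset_union.
Proof.
move=> H_compact; rewrite /coset_union bigcup_mkord.
apply: (big_ind (@compact _)); [exact: compact0 | by move=> A B; exact: compactU |].
move=> a _; apply: continuous_compact => //; apply: continuous_subspaceT.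
exact: torus_mul_continuous.
Qed.

Section Average.
Variable muH : probability (borel T) R.
Hypothesis H_closed : closed H.
Hypothesis muH_haar : is_normalized_haar H muH.
Local Notation mu := (mu_average muH nu d).

Lemma mu_averageE (A : set (borel T)) :
  mu A = ((d%:R^-1)%:E * \sum_(a < d) muH (translate (nu ^+ a)%g @^-1` A))%E.
Proof. by []. Qed.

Lemma mu_average1 (A : set (borel T)) :
  (forall a : 'I_d, muH (translate (nu ^+ a)%g @^-1` A) = 1%E) -> mu A = 1%E.
Proof.
move=> A1; rewrite mu_averageE (eq_bigr (fun=> 1%E)) => [|a _]; last exact: A1.
rewrite sumEFin sumr_const card_ord -EFinM mulVf// pnatr_eq0 -lt0n //.
Qed.

Lemma mu_averageT : mu setT = 1%E.
Proof. by apply: mu_average1 => a; rewrite preimage_setT probability_setT. Qed.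

Lemma mu_average_coset_union : measurable (coset_union : set (borel T)) -> mu coset_union = 1%E.
Proof.
move=> mU; apply: mu_average1 => a; apply/eqP; rewrite eq_le; apply/andP; split.
  by apply: probability_le1; rewrite -[X in measurable X]setTI; exact: measurable_translate.
rewrite -(proj1 muH_haar); apply: le_measure; rewrite ?inE.
- exact: closed_borel_measurable.
- by rewrite -[X in measurable X]setTI; exact: measurable_translate.
by move=> z Hz; apply: coset_union_mul; [exact: coset_unionX | exact: coset_union_sub].
Qed.

(** Translation by [nu] sends the [a]-th coset measure to the next one, and the
    last one to the first because the measure on [H] is invariant under
    [nu ^+ d]. *)
Lemma mu_average_invariant (A : set (borel T)) :
  measurable A -> mu (translate nu @^-1` A) = mu A.
Proof.
move=> mA; rewrite !mu_averageE; congr (_ * _)%E.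
pose F a := muH (translate (nu ^+ a)%g @^-1` A).
transitivity (\sum_(a < d) F a.+1)%E.
  apply: eq_bigr => a _; congr (muH _); apply/funext => z /=.
  by rewrite /translate mulgA expgS.
have Fd : F d = F 0.
  rewrite /F; have -> : translate (nu ^+ d)%g @^-1` A = translate (nu ^+ d)^-1%g @` A.
    apply/seteqP; split => [z Az|_ [z Az <-]].
      by exists (translate (nu ^+ d)%g z) => //; rewrite /translate mulKg.
    by rewrite /preimage/= /translate mulVKg.
  rewrite (proj2 muH_haar)//; last exact: HV.
  by congr (muH _); apply/funext => z /=; rewrite /translate mul1g.
rewrite -/(F _); case: d d_gt0 Fd => // e _ Fe.
by rewrite big_ord_recr [RHS]big_ord_recl /= Fe addeC.
Qed.

End Average.
End CosetUnion.

(** * The closure and the equidistribution *)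

(** Multiplication by [d] makes the [c j] integers, so their contribution
    [2 pi * d * c j] to the angles disappears on the circle. *)
Lemma nu_theta_expd (R : realType) (m s : nat) (theta : 'I_(m + s) -> R)
    (c : 'I_s -> rat) (b : 'I_m -> 'I_s -> rat) (h : 'I_m -> 'I_s -> int) :
  (forall j : 'I_s, theta (rshift m j) =
     2 * pi * ratr (c j) + \sum_(k < m) ratr (b k j) * theta (lshift s k)) ->
  (forall k j, (h k j)%:~R = (lcm_denoms c b)%:R * b k j) ->
  (nu_theta theta ^+ lcm_denoms c b)%g =
    H_param (lcm_denoms c b) h (fun k => cis (theta (lshift s k))).
Proof.
move=> hrel hh; apply/funext => i; rewrite torusXE -(splitK i).
case: (fintype.split i) => j /=; first by rewrite H_param_lshift.
rewrite H_param_rshift -cisMn hrel mulrDl cisD.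
have [q qE] := lcm_denomsM_int c b j.
have -> : 2 * pi * ratr (c j) * (lcm_denoms c b)%:R = 2 * pi * q%:~R :> R.
  by rewrite -mulrA; congr (_ * _); rewrite -(ratr_int R q) -qE rmorphM /= ratr_nat mulrC.
rewrite cis_2piz mul1g mulr_suml cis_sum; apply: eq_bigr => k _.
rewrite -cisMz; congr cis.
by rewrite -(ratr_int R (h k j)) hh rmorphM /= ratr_nat mulrC mulrA mulrC.
Qed.

Lemma Re_scaled_sum (R : realType) (a : R) (F : nat -> Cplx R) N :
  complex.Re (a%:C * \sum_(1 <= k < N.+1) F k : Cplx R) =
  a * \sum_(k < N) complex.Re (F k.+1) /\
  complex.Im (a%:C * \sum_(1 <= k < N.+1) F k : Cplx R) =
  a * \sum_(k < N) complex.Im (F k.+1).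
Proof.
have -> : \sum_(1 <= k < N.+1) F k =
    (\sum_(k < N) complex.Re (F k.+1)) +i* (\sum_(k < N) complex.Im (F k.+1)).
  elim: N => [|N IHN]; first by rewrite big_geq// !big_ord0.
  by rewrite big_nat_recr//= IHN !big_ord_recr/=; case: (F N.+1).
by rewrite /= !mul0r subr0 addr0.
Qed.

Theorem theorem1p3 (R : realType) (m s : nat) (theta : 'I_(m + s) -> R)
    (c : 'I_s -> rat) (b : 'I_m -> 'I_s -> rat)
    (d : nat) (h : 'I_m -> 'I_s -> int)
    (* m + 1 = dim_Q Span_Q (pi, theta_1, ..., theta_r), where r = m + s *)
    (hdim : Qdim (Qspan (fcons pi theta)) m.+1)
    (* (2 pi, theta_1, ..., theta_m) is a basis of this space *)
    (hbasis : Qbasis (Qspan (fcons pi theta))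
                (fcons (2 * pi) (fun k : 'I_m => theta (lshift s k))))
    (hrel : forall j : 'I_s, theta (rshift m j) =
       2 * pi * ratr (c j) + \sum_(k < m) ratr (b k j) * theta (lshift s k))
    (hd : d = lcm_denoms c b)
    (hh : forall k j, (h k j)%:~R = d%:R * b k j)
    (muH : probability (borel (torus R (m + s))) R)
    (hmuH : is_normalized_haar (H_theta d h) muH) :
  [/\ closure (Gamma_theta theta) =
        \bigcup_(a < d) [set (nu_theta theta ^+ a * z)%g | z in H_theta d h],
      closure (Gamma_theta theta) =
        set_mul (generated [set nu_theta theta]) (H_theta d h)
    & forall f : torus R (m + s) -> Cplx R, continuous f ->
        (fun X : R => (X^-1)%:C *
           \sum_(1 <= n < (Num.truncn X).+1) f (torus_point theta n%:R) : Cplx R)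
        @ +oo --> Cintegral (mu_average muH (nu_theta theta) d)
                    (closure (Gamma_theta theta)) f].
Proof.
set nu := nu_theta theta; set H := H_theta d h.
have d_gt0 : (0 < d)%N by rewrite hd lcm_denoms_gt0.
pose w : torus R m := fun k => cis (theta (lshift s k)).
have nudE : (nu ^+ d)%g = H_param d h w.
  by move: hh; rewrite hd; exact: nu_theta_expd.
have H1 : H 1%g by exists 1%g => //; exact: H_param1.
have HM x y : H x -> H y -> H (x * y)%g.
  by move=> [z _ <-] [z' _ <-]; exists (z * z')%g => //; exact: H_paramM.
have HV x : H x -> H x^-1%g.
  by move=> [z _ <-]; exists z^-1%g => //; exact: H_paramV.
have nudH : H (nu ^+ d)%g by rewrite nudE; exists w.
have H_compact : compact H.
  apply: continuous_compact; last exact: torus_compact.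
  by apply: continuous_subspaceT; exact: H_param_continuous.
pose U := coset_union nu H d.
have U_compact : compact U by exact: coset_union_compact.
have U_closed : closed U by exact: compact_closed (@torus_hausdorff _ _) U_compact.
(* The orbit exponents [a + d * k] move along [nu ^+ a * H] following the powers
   of [w], which are dense in the parameters. *)
have U_dense y : U y -> forall e : R, 0 < e -> exists j : nat, torus_close e y (nu ^+ j)%g.
  move=> [a _ [_ [z _ <-] <-]] e e_gt0.
  have phi_cont : continuous (fun z : torus R m => (nu ^+ a * H_param d h z)%g).
    move=> z'; apply: (@continuous_comp _ _ _ (H_param d h) (fun x => (nu ^+ a * x)%g)).
      exact: H_param_continuous.
    exact: torus_mul_continuous.
  have /nbhs_torus_close[delta delta_gt0 deltaP] := phi_cont z _ (near_torus_close _ e_gt0).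
  have [k kP] := kronecker_approximation z (proj1 hbasis) delta_gt0.
  exists (a + d * k)%N; rewrite expgnDr expgnA.
  have -> : ((nu ^+ d) ^+ k)%g =
      H_param d h (w ^+ k)%g.
    rewrite nudE; elim: k {kP} => [|k IHk]; first by rewrite H_param1.
    by rewrite !expgS H_paramM IHk.
  apply: deltaP => i; rewrite distrC torusXE; exact: kP.
have closureE : closure (Gamma_theta theta) = U.
  apply/seteqP; split.
    have UE : U = closure U by exact: (closure_id U).1.
    rewrite UE; apply: closureS.
    by move=> _ [X _ <-]; rewrite torus_point_intE; exact: coset_unionXz.
  move=> y Uy B /nbhs_torus_close[e e_gt0 eB]; have [j yj] := U_dense y Uy e e_gt0.
  exists (nu ^+ j)%g; split; last exact: eB.
  by exists (Posz j) => //; rewrite torus_point_intE.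
rewrite closureE; split; first by [].
  exact: coset_union_generated.
move=> f f_cont.
pose mu := mu_average muH nu d.
have mU : measurable (U : set (borel (torus R (m + s)))) by exact: closed_borel_measurable.
have cvg_real (g : torus R (m + s) -> R) : continuous g ->
    (fun X : R => X^-1 * \sum_(k < Num.truncn X) g (torus_point theta k.+1%:R)) @ +oo -->
    Rintegral mu U g.
  move=> g_cont.
  have -> : (fun X : R => X^-1 * \sum_(k < Num.truncn X) g (torus_point theta k.+1%:R)) =
      fun X : R => X^-1 * birkhoff_sum nu g (Num.truncn X) 1%g.
    apply/funext => X; congr (_ * _); apply: eq_bigr => k _.
    by rewrite torus_point_natE mulg1.
  apply: birkhoff_average_cvg => //.
  - exact: mu_averageT.
  - move=> A mA; exact: (mu_average_invariant d_gt0 HV nudH hmuH).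
  - apply: (mu_average_coset_union d_gt0 H1 HM nudH _ hmuH mU).
    exact: compact_closed (@torus_hausdorff _ _) H_compact.
apply: Cplx_cvg.
  under eq_fun do rewrite (proj1 (Re_scaled_sum _ _ _)).
  apply: cvg_real => y.
  by apply: (@continuous_comp _ _ _ f (fun z : Cplx R => complex.Re z : R));
    [exact: f_cont | exact: Re_continuous].
under eq_fun do rewrite (proj2 (Re_scaled_sum _ _ _)).
apply: cvg_real => y.
by apply: (@continuous_comp _ _ _ f (fun z : Cplx R => complex.Im z : R));
  [exact: f_cont | exact: Im_continuous].
Qed.
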